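(* Let $n\geq 2$ be an integer and let $S_1,S_2$ be positive real numbers such that $(n-1)S_2<S_1^2<nS_2$. Let $x_1,\dots,x_n>0$ satisfy $x_1+\cdots+x_n=S_1$ and $x_1^2+\cdots+x_n^2=S_2$. Let $E=\sum_{1\leq i<j\leq n}(x_i-x_j)^2$ and $\Delta=\prod_{i<j}(x_i-x_j)^2$. Then \[ \left(\frac{E}{\binom{n}{2}}\right)^{\binom{n}{2}}\geq \frac{(2n)^{\binom{n}{2}}}{Y(n)}\,\Delta, \] where $Y(n)=2^2\,3^3\cdots n^n$ is the hyperfactorial.
   Context: $E$ is the potential energy and $\Delta$ the discriminant of $x_1,\dots,x_n$. *)

(* Defs.v *)
From HB Require Import structures.
From mathcomp Require Import all_boot all_order all_algebra.
From mathcomp Require Import reals.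

Set Implicit Arguments.
Unset Strict Implicit.
Unset Printing Implicit Defensive.

Import Order.TTheory GRing.Theory Num.Theory.

Local Open Scope ring_scope.

Definition potential_energy (R : realType) (n : nat) (x : 'I_n -> R) : R :=
  \sum_(i < n) \sum_(j < n | (i < j)%N) (x i - x j) ^+ 2.

Definition discriminant (R : realType) (n : nat) (x : 'I_n -> R) : R :=
  \prod_(i < n) \prod_(j < n | (i < j)%N) (x i - x j) ^+ 2.

Definition hyperfactorial (n : nat) : nat :=
  (\prod_(2 <= k < n.+1) k ^ k)%N.

(* Main.v *)
(* Let h_1, ..., h_n be the roots of the monic Hermite polynomial H_n, and let
   N = 'C(n, 2). The equation H_n'' - 2 X H_n' + 2 n H_n = 0 gives the Stieltjes
   relations sum_(j <> i) 1 / (h_i - h_j) = h_i; hence the h_i are centered,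
   their squares sum to N, and for every x,
   sum_(i < j) (x_i - x_j) / (h_i - h_j) = sum_i x_i h_i.
   If the h_i are numbered in the same order as the x_i, these quotients are
   nonnegative, and AM-GM bounds Delta(x) / Delta(h) by
   (sum_i x_i h_i / N)^(2 N), so by (E / (n N))^N thanks to Cauchy-Schwarz.
   Finally Delta(h) = Y(n) / 2^N. The maximum of Delta is thus identified
   without any compactness argument or Lagrange multiplier. *)

Require Import Defs.
From HB Require Import structures.
From mathcomp Require Import all_boot all_order all_algebra.
From mathcomp Require Import reals complex ring.

Set Implicit Arguments.
Unset Strict Implicit.
Unset Printing Implicit Defensive.

Import Order.TTheory GRing.Theory Num.Theory.

Local Open Scope ring_scope.

(** * Monic Hermite polynomials and their differential equation *)

(** Physicists' normalisation divided by $2^n$. Using the derivative rather than the three-term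
    recurrence keeps every induction one-step. *)
Fixpoint hermite (F : numFieldType) (n : nat) : {poly F} :=
  if n is m.+1 then 'X * hermite F m - 2^-1 *: (hermite F m)^`() else 1.

Lemma hermiteS (F : numFieldType) n :
  hermite F n.+1 = 'X * hermite F n - 2^-1 *: (hermite F n)^`().
Proof. by []. Qed.

(** Appell property: by the induction hypothesis, differentiating the recursion reproduces it with a
    factor, plus one extra copy of the previous polynomial. *)
Lemma deriv_hermite (F : numFieldType) n :
  (hermite F n.+1)^`() = n.+1%:R *: hermite F n.
Proof.
elim: n => [|n IH]; first by rewrite /= mulr1 derivC scaler0 subr0 derivX scale1r.
rewrite hermiteS derivB derivM derivX derivZ mul1r IH derivZ scalerA [2^-1 * _]mulrC -scalerA -scalerAr.
by rewrite -addrA -scalerBr -hermiteS -[in RHS]natr1 scalerDl scale1r addrC.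
Qed.

Lemma size_hermite (F : numFieldType) n : size (hermite F n) = n.+1.
Proof.
elim: n => [|n IH]; first by rewrite size_poly1.
have szX : size ('X * hermite F n) = n.+2.
  by rewrite mulrC size_mulX ?IH // -size_poly_eq0 IH.
rewrite hermiteS size_polyDl szX // size_polyN.
apply: leq_ltn_trans (size_scale_leq _ _) _.
by apply: leq_trans (lt_size_deriv _) _; rewrite ?IH // -size_poly_eq0 IH.
Qed.

Lemma monic_hermite (F : numFieldType) n : hermite F n \is monic.
Proof.
elim: n => [|n IH]; first exact: monic1.
have nz : hermite F n != 0 by rewrite -size_poly_eq0 size_hermite.
rewrite hermiteS monicE lead_coefDl ?size_polyN.
  by rewrite mulrC lead_coefMX -monicE.
apply: leq_ltn_trans (size_scale_leq _ _) _.
by apply: ltn_trans (lt_size_deriv _) _; rewrite // mulrC size_mulX.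
Qed.

(** Descent: a double root of [hermite n.+1] is a root of [hermite n] by the Appell property, and a
    double one by the recursion; but [hermite 0] is 1. *)
Lemma hermite_simple_root (F : numFieldType) n (a : F) :
  root (hermite F n) a -> (hermite F n)^`().[a] != 0.
Proof.
elim: n => [|n IH]; first by rewrite /= /root hornerE oner_eq0.
move=> ra; rewrite deriv_hermite hornerZ mulf_neq0 ?pnatr_eq0 //.
apply/negP => rb; move: ra; rewrite /root hermiteS !hornerE (eqP rb) mulr0 sub0r.
by rewrite oppr_eq0 mulf_eq0 invr_eq0 pnatr_eq0 /=; apply/negP/IH.
Qed.

Lemma hermite_deriv2_root (F : numFieldType) n (a : F) :
  root (hermite F n) a ->
  (hermite F n)^`()^`().[a] = 2 * a * (hermite F n)^`().[a].
Proof.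
case: n => [|n]; first by rewrite /root hornerE oner_eq0.
rewrite /root deriv_hermite derivZ hermiteS hornerD hornerN !hornerZ hornerM hornerX => /eqP.
set p := (hermite F n).[a]; set d := (hermite F n)^`().[a] => Hp.
(* The inner bracket is the value of [hermite n.+1] at the root, hence 0. *)
have -> : d = 2 * (a * p - (a * p - 2^-1 * d)) by field.
by rewrite Hp; ring.
Qed.

(** * Split polynomials and the Stieltjes relations *)

Lemma horner_deriv_prod_XsubC (F : numFieldType) (s : seq F) (a : F) :
  a \notin s ->
  (\prod_(b <- s) ('X - b%:P))^`().[a] =
  (\prod_(b <- s) (a - b)) * \sum_(b <- s) (a - b)^-1.
Proof.
elim: s => [|b s IH]; first by rewrite !big_nil derivC mulr0 hornerE.
rewrite inE negb_or => /andP[ab aNs].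
rewrite !big_cons derivM derivXsubC mul1r hornerD hornerM IH // horner_prod.
under eq_bigr do rewrite hornerXsubC.
by rewrite hornerXsubC; field; rewrite subr_eq0.
Qed.

Lemma horner_deriv_prod_XsubC_root (F : numFieldType) (s : seq F) (a : F) :
  uniq s -> a \in s ->
  (\prod_(b <- s) ('X - b%:P))^`().[a] = \prod_(b <- s | b != a) (a - b).
Proof.
move=> us ain; rewrite (bigD1_seq a) //= derivM derivXsubC hornerD !hornerM.
rewrite hornerXsubC subrr mul0r addr0 hornerE mul1r horner_prod.
by under eq_bigr do rewrite hornerXsubC.
Qed.

Lemma uniq_hermite_roots (F : numFieldType) n (s : seq F) :
  hermite F n = \prod_(a <- s) ('X - a%:P) -> uniq s.
Proof.
(* Simplicity of the roots is restated for the bare product, since the tail of [s] no longer gives a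
   Hermite polynomial. *)
move=> Hs; have : forall a, a \in s -> (\prod_(a <- s) ('X - a%:P))^`().[a] != 0.
  by move=> a ain; rewrite -Hs hermite_simple_root // Hs root_prod_XsubC.
elim: s {Hs} => // a s IH Hs /=.
have aNs : a \notin s.
  apply/negP => ain; have := Hs a; rewrite inE eqxx => /(_ isT).
  rewrite big_cons derivM hornerD !hornerM hornerXsubC subrr mul0r addr0.
  by rewrite [_.[a] in X in _ * X](rootP _) ?root_prod_XsubC // mulr0 eqxx.
rewrite aNs IH // => b bs; have := Hs b; rewrite inE bs orbT => /(_ isT).
rewrite big_cons derivM hornerD !hornerM.
rewrite [X in _ * X + _](rootP _) ?root_prod_XsubC // mulr0 add0r.
by rewrite mulf_eq0 negb_or => /andP[].
Qed.

(** Writing the polynomial as $(X - a) Q$, its first two derivatives at $a$ are $Q(a)$ and $2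
    Q'(a)$, so the Hermite equation says that the logarithmic derivative of $Q$ at $a$ is $a$. *)
Lemma hermite_stieltjes (F : numFieldType) n (s : seq F) (a : F) :
  hermite F n = \prod_(b <- s) ('X - b%:P) -> a \in s ->
  \sum_(b <- s | b != a) (a - b)^-1 = a.
Proof.
move=> Hs ain; have us := uniq_hermite_roots Hs.
have := @hermite_deriv2_root F n a; rewrite Hs root_prod_XsubC => /(_ ain).
rewrite horner_deriv_prod_XsubC_root // (bigD1_seq a) //=.
rewrite -!(big_filter _ (fun b => b != a)) /=.
set t := [seq _ <- _ | _]; have aNt : a \notin t by rewrite mem_filter eqxx.
rewrite derivM derivXsubC mul1r derivD derivM derivXsubC mul1r !hornerD hornerM.
rewrite hornerXsubC subrr mul0r addr0 horner_deriv_prod_XsubC //.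
set P := \prod_(b <- _) _; have nzP : P != 0.
  rewrite prodf_seq_neq0; apply/allP => b bt /=.
  by rewrite subr_eq0; apply: contraNneq aNt => ->.
move=> E; have {}E : P * (2 * \sum_(b <- t) (a - b)^-1) = P * (2 * a).
  by rewrite mulrCA; ring: E.
by apply: (mulfI (x := 2)); [rewrite pnatr_eq0|exact: (mulfI nzP)].
Qed.

(** * Real-rootedness, by way of the complex roots *)

Lemma map_hermite (F K : numFieldType) (f : {rmorphism F -> K}) n :
  map_poly f (hermite F n) = hermite K n.
Proof.
elim: n => [|n IH]; first by rewrite rmorph1.
by rewrite !hermiteS rmorphB rmorphM /= map_polyX map_polyZ /= -deriv_map IH fmorphV rmorph_nat.
Qed.

Lemma ImV_le0 (R : rcfType) (z : R[i]) :
  0 <= complex.Im z -> complex.Im z^-1 <= 0.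
Proof.
case: z => a b /= b0; rewrite oppr_le0 mulr_ge0 // invr_ge0.
by rewrite addr_ge0 ?sqr_ge0.
Qed.

Lemma seq_max (d : Order.disp_t) (T : orderType d) (U : eqType) (f : U -> T)
    (s : seq U) (x : U) : x \in s ->
  exists2 y, y \in s & forall z, z \in s -> (f z <= f y)%O.
Proof.
elim: s x => // a [|b s] IH x _.
  by exists a; rewrite ?inE // => z; rewrite inE => /eqP->.
have [y yin yP] := IH b (mem_head _ _).
have [le|/ltW ge] := leP (f a) (f y).
  by exists y; [rewrite inE yin orbT|move=> z; rewrite inE => /predU1P[->|/yP]].
exists a => [|z]; first exact: mem_head.
by rewrite inE => /predU1P[->|/yP zy] //; apply: le_trans ge.
Qed.

(* At a root [y] of maximal imaginary part, every term of the Stieltjes sum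
   [y = \sum_b (y - b)^-1] has a nonpositive imaginary part. *)
Lemma Im_hermite_root_le0 (R : rcfType) n (z : R[i]) :
  root (hermite (complex R) n) z -> complex.Im z <= 0.
Proof.
have [s] := closed_field_poly_normal (hermite (complex R) n).
rewrite (monicP (monic_hermite _ n)) scale1r => Hs.
rewrite Hs root_prod_XsubC => zs.
have [y ys ymax] := seq_max (@complex.Im R) zs.
apply: le_trans (ymax z zs) _.
rewrite -(hermite_stieltjes Hs ys).
rewrite (big_morph (@complex.Im R) (id1 := 0) (op1 := +%R)) //; last first.
  by case=> ? ? [].
rewrite big_seq_cond sumr_le0 // => b /andP[bs _]; apply: ImV_le0.
have := ymax b bs; case: (b) (y) => ? ? [? ?] /=; by rewrite subr_ge0.
Qed.

(** The complex roots are stable under conjugation, so the one-sided bound on imaginary parts,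
    applied to a root and to its conjugate, makes them vanish. *)
Lemma hermite_real_rooted (R : rcfType) n :
  exists s : seq R, hermite R n = \prod_(a <- s) ('X - a%:P).
Proof.
have [s] := closed_field_poly_normal (hermite (complex R) n).
rewrite (monicP (monic_hermite _ n)) scale1r => Hs.
exists [seq complex.Re z | z <- s].
apply: (map_poly_inj (real_complex R)).
rewrite map_hermite Hs rmorph_prod big_map !big_seq; apply: eq_bigr => z zs.
rewrite /= map_polyXsubC /=; congr ('X - _%:P).
have rz : root (hermite (complex R) n) z by rewrite Hs root_prod_XsubC.
have rz' : root (hermite (complex R) n) (conjc z).
  rewrite -(map_hermite (@conjc R)) /root horner_map /=.
  by rewrite (eqP rz) conjc0.
have := Im_hermite_root_le0 rz; have := Im_hermite_root_le0 rz'.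
case: (z) => a b /=; rewrite oppr_le0 => b0 b1.
by congr Complex; apply/eqP; rewrite eq_le b0 b1.
Qed.

(** * Discriminant of the Hermite polynomials *)

Lemma hyperfactorialS n :
  hyperfactorial n.+1 = (n.+1 ^ n.+1 * hyperfactorial n)%N.
Proof.
rewrite /hyperfactorial; case: n => [|n]; first by rewrite !big_geq.
by rewrite big_nat_recr //= mulnC.
Qed.

Lemma size_hermite_roots (F : numFieldType) n (s : seq F) :
  hermite F n = \prod_(a <- s) ('X - a%:P) -> size s = n.
Proof. by move=> Hs; have [] := size_hermite F n; rewrite Hs size_prod_XsubC => -[]. Qed.

(* Both factors of the recursion [D(n+1) = (n+1)^(n+1) 2^-n D(n)] come from
   the resultant of [hermite n] and [hermite n.+1]: at the roots of
   [hermite n.+1] its derivative is [(n+1) hermite n], and at the roots of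
   [hermite n] the polynomial [hermite n.+1] is [- (hermite n)' / 2]. *)
Lemma hermite_discriminant (R : rcfType) n (s : seq R) :
  hermite R n = \prod_(a <- s) ('X - a%:P) ->
  \prod_(a <- s) \prod_(b <- s | b != a) `|a - b| =
  (hyperfactorial n)%:R / 2 ^+ 'C(n, 2).
Proof.
(* At a root, the product of the differences with the other roots is the derivative. *)
have discE m (t : seq R) : hermite R m = \prod_(a <- t) ('X - a%:P) ->
    \prod_(a <- t) \prod_(b <- t | b != a) `|a - b| =
    \prod_(a <- t) `|(hermite R m)^`().[a]|.
  move=> Ht; rewrite !big_seq; apply: eq_bigr => a at_.
  rewrite Ht horner_deriv_prod_XsubC_root ?normr_prod //.
  exact: uniq_hermite_roots Ht.
elim: n s => [|n IH] s Hs.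
  have /size0nil-> := size_hermite_roots Hs.
  by rewrite big_nil /hyperfactorial big_geq // divr1.
have [t Ht] := hermite_real_rooted R n.
rewrite (discE _ _ Hs); under eq_bigr do
  rewrite deriv_hermite hornerZ normrM normr_nat Ht horner_prod normr_prod.
rewrite big_split /= big_const_seq count_predT iter_mulr_1 (size_hermite_roots Hs) exchange_big /=.
have -> : \prod_(b <- t) \prod_(a <- s) `|('X - b%:P).[a]| =
          \prod_(b <- t) (2^-1 * `|(hermite R n)^`().[b]|).
  rewrite !big_seq; apply: eq_bigr => b bt.
  have rb : root (hermite R n) b by rewrite Ht root_prod_XsubC.
  have <- : `|(hermite R n.+1).[b]| = 2^-1 * `|(hermite R n)^`().[b]|.
    rewrite hermiteS hornerD hornerN hornerM hornerZ (rootP rb) mulr0 sub0r.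
    by rewrite normrN normrM ger0_norm // invr_ge0.
  rewrite Hs horner_prod normr_prod; apply: eq_bigr => a _.
  by rewrite !hornerXsubC distrC.
rewrite big_split /= big_const_seq count_predT iter_mulr_1 (size_hermite_roots Ht) -(discE _ _ Ht).
rewrite (IH _ Ht) hyperfactorialS binS bin1 exprD natrM natrX exprVn.
by field; rewrite !expf_neq0 // pnatr_eq0.
Qed.

(** * Numbering the roots, and sums and products over pairs of indices *)

Lemma comonotone_reindexing (R : realDomainType) n (x : 'I_n -> R) (s : seq R) :
  size s = n ->
  exists2 h : 'I_n -> R, perm_eq [seq h i | i <- enum 'I_n] s &
    forall i j, h i < h j -> x i <= x j.
Proof.
move=> szs; pose le := relpre x <=%O.
pose e := sort le (enum 'I_n); pose s' := sort <=%O s.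
have sze : size e = n by rewrite size_sort size_enum_ord.
have ine i : i \in e by rewrite mem_sort mem_enum.
have idx i : (index i e < n)%N by rewrite -[X in (_ < X)%N]sze index_mem.
have szs' : size s' = n by rewrite size_sort.
(* An index of rank $k$ for [x] receives the $k$-th smallest entry of [s]; ties in [x] are broken by
   the sort. *)
exists (fun i => nth 0 s' (index i e)).
  apply: (@perm_trans _ [seq nth 0 s' (index i e) | i <- e]).
    by apply: perm_map; rewrite perm_sym perm_sort.
  suff -> : [seq nth 0 s' (index i e) | i <- e] = s' by rewrite perm_sort.
  apply: (@eq_from_nth _ 0); rewrite size_map ?sze // => k kn.
  by rewrite (nth_map (Ordinal kn)) ?index_uniq ?sort_uniq ?enum_uniq ?sze.
move=> i j; apply: contraTT; rewrite -ltNge -leNgt => xji.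
have le_tr : transitive le by move=> ? ? ?; apply: le_trans.
have le_tot : total le by move=> ? ?; apply: le_total.
apply: (sorted_leq_nth le_trans lexx); rewrite ?inE ?szs' ?idx //.
  exact/sort_sorted/le_total.
rewrite leqNgt; apply/negP => ltij.
have := sorted_ltn_index le_tr (sort_sorted le_tot _) i j (ine i) (ine j) ltij.
by rewrite /le /= leNgt xji.
Qed.

Lemma prod_offdiag_ltn (R : comNzRingType) n (G : 'I_n -> 'I_n -> R) :
  (forall i j, G i j = G j i) ->
  \prod_(i < n) \prod_(j < n | j != i) G i j =
  \prod_(i < n) \prod_(j < n | (i < j)%N) G i j ^+ 2.
Proof.
move=> Gsym.
have -> : \prod_(i < n) \prod_(j < n | j != i) G i j =
   \prod_(i < n) \prod_(j < n | (i < j)%N) G i j *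
   \prod_(i < n) \prod_(j < n | (j < i)%N) G i j.
  rewrite -big_split; apply: eq_bigr => i _ /=.
  rewrite (bigID (fun j : 'I_n => (i < j)%N)) /=; congr (_ * _).
    by apply: eq_bigl => j; rewrite -val_eqE /=; case: ltngtP.
  by apply: eq_bigl => j; rewrite -val_eqE /=; case: ltngtP.
rewrite [X in _ * X](exchange_big_dep predT) //= -big_split /=.
apply: eq_bigr => i _; rewrite -big_split /=.
by apply: eq_bigr => j _; rewrite [G j i]Gsym expr2.
Qed.

(** Over ordered pairs each difference occurs twice, which accounts for the square; absolute values
    remove the sign. *)
Lemma discriminantE (R : realType) n (x : 'I_n -> R) :
  discriminant x = \prod_(i < n) \prod_(j < n | j != i) `|x i - x j|.
Proof.
rewrite prod_offdiag_ltn => [|i j]; last exact: distrC.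
by apply: eq_bigr => i _; apply: eq_bigr => j _; rewrite real_normK ?num_real.
Qed.

Lemma potential_energyE (R : realType) n (x : 'I_n -> R) :
  potential_energy x =
  n%:R * \sum_(i < n) x i ^+ 2 - (\sum_(i < n) x i) ^+ 2.
Proof.
(* The diagonal contributes 0, so the square can be expanded over all ordered pairs without side
   condition. *)
have dbl : \sum_(i < n) \sum_(j < n) (x i - x j) ^+ 2 = 2 * potential_energy x.
  rewrite mulrDl !mul1r /potential_energy [X in _ = _ + X](exchange_big_dep predT) //=.
  rewrite -big_split /=; apply: eq_bigr => i _.
  rewrite (bigID (fun j : 'I_n => (i < j)%N)) /=; congr (_ + _).
  rewrite (bigD1 i) ?ltnn //= subrr expr0n add0r.
  apply: eq_big => j; first by rewrite -val_eqE /=; case: ltngtP.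
  by rewrite -sqrrN opprB.
apply: (mulfI (x := 2)); first by rewrite pnatr_eq0.
rewrite -dbl.
under eq_bigr => i _.
  under eq_bigr do rewrite sqrrB.
  rewrite !big_split /= sumr_const card_ord sumrN sumrMnl -mulr_sumr.
  over.
rewrite !big_split /= sumr_const card_ord sumrN !sumrMnl -mulr_suml.
by rewrite -[X in X - _ + _]mulr_natl -[X in _ + X]mulr_natl; ring.
Qed.

Lemma cauchy_schwarz_sum (R : realFieldType) (I : finType) (a b : I -> R) :
  (\sum_i a i * b i) ^+ 2 <= (\sum_i a i ^+ 2) * (\sum_i b i ^+ 2).
Proof.
set A := \sum_i a i ^+ 2; set B := \sum_i b i ^+ 2; set C := \sum_i a i * b i.
have B0 : 0 <= B by apply: sumr_ge0 => i _; apply: sqr_ge0.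
have [B_eq0|B_neq0] := eqVneq B 0.
  suff -> : C = 0 by rewrite B_eq0 expr0n mulr0.
  apply: big1 => i _; move/eqP: B_eq0; rewrite psumr_eq0 => [|j _]; last exact: sqr_ge0.
  by move=> /allP/(_ i (mem_index_enum i)); rewrite sqrf_eq0 => /eqP->; rewrite mulr0.
(* Up to the factor [B], these are the components of [a] orthogonal to [b]. *)
have : 0 <= \sum_i (a i * B - C * b i) ^+ 2 by apply: sumr_ge0 => i _; apply: sqr_ge0.
have -> : \sum_i (a i * B - C * b i) ^+ 2 = B * (A * B - C ^+ 2).
  transitivity (\sum_i (B ^+ 2 * a i ^+ 2 - 2 * B * C * (a i * b i) + C ^+ 2 * b i ^+ 2)).
    by apply: eq_bigr => i _; ring.
  by rewrite !big_split /= sumrN -!mulr_sumr -/A -/B -/C; ring.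
by rewrite pmulr_rge0 ?lt_def ?B_neq0 // subr_ge0.
Qed.

Lemma card_offdiag n : #|[pred p : 'I_n * 'I_n | p.2 != p.1]| = ('C(n, 2) * 2)%N.
Proof.
rewrite -sum1_card -(pair_big_dep xpredT (fun i j : 'I_n => j != i) (fun _ _ => 1%N)) /=.
under eq_bigr => i _ do rewrite sum1_card cardC1 card_ord.
rewrite sum_nat_const card_ord -[2%N]/(2`!) bin_ffact.
by case: n => // n; rewrite ffactnS ffactn1.
Qed.

(** * Stieltjes relations combined with AM-GM *)

(** The [y i] and [y j] parts are exchanged by swapping indices, and each sums to $\sum_i y_i h_i$
    by the relations. The vector [y] stays free because constant vectors and [h] itself are also of
    use. *)
Lemma sum_offdiag_Stieltjes (R : fieldType) n (h y : 'I_n -> R) :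
  (forall i, \sum_(j < n | j != i) (h i - h j)^-1 = h i) ->
  \sum_(i < n) \sum_(j < n | j != i) (y i - y j) / (h i - h j) =
  2 * \sum_(i < n) y i * h i.
Proof.
move=> hS.
have -> : \sum_(i < n) \sum_(j < n | j != i) (y i - y j) / (h i - h j) =
    \sum_(i < n) \sum_(j < n | j != i) y i / (h i - h j) +
    \sum_(i < n) \sum_(j < n | j != i) y j / (h j - h i).
  rewrite -big_split; apply: eq_bigr => i _; rewrite -big_split.
  apply: eq_bigr => j _ /=.
  by rewrite -[h j - h i]opprB invrN mulrN mulrBl.
rewrite [X in _ + X](exchange_big_dep predT) //= mulrDl mul1r.
have half : \sum_(i < n) \sum_(j < n | j != i) y i / (h i - h j) =
            \sum_(i < n) y i * h i.
  by apply: eq_bigr => i _; rewrite -mulr_sumr hS.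
rewrite {1}half; congr (_ + _); rewrite -half.
by apply: eq_bigr => i _; apply: eq_bigl => j; rewrite eq_sym.
Qed.

(* AM-GM applied to the quotients [(y i - y j) / (h i - h j)], whose sum is
   known from the Stieltjes relations. *)
Lemma discriminant_le_Stieltjes (R : realType) n (h y : 'I_n -> R) :
  injective h ->
  (forall i, \sum_(j < n | j != i) (h i - h j)^-1 = h i) ->
  (forall i j, h i < h j -> y i <= y j) ->
  discriminant y <=
  discriminant h * (((\sum_(i < n) y i * h i) / 'C(n, 2)%:R) ^+ 2) ^+ 'C(n, 2).
Proof.
move=> h_inj hS hy.
pose A := [pred p : 'I_n * 'I_n | p.2 != p.1].
pose t (p : 'I_n * 'I_n) := (y p.1 - y p.2) / (h p.1 - h p.2).
have t_ge0 p : p \in A -> 0 <= t p.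
  case: p => i j; rewrite inE /t /= => ij.
  have [lt|gt|/h_inj eq] := ltgtP (h i) (h j); last by rewrite eq eqxx in ij.
    by rewrite -mulrNN -invrN !opprB divr_ge0 // subr_ge0 ?hy // ltW.
  by rewrite divr_ge0 // subr_ge0 ?hy // ltW.
(* With $N$ the binomial coefficient, there are $2N$ ordered pairs: the product is
   $\Delta(y)/\Delta(h)$, and the factor 2 in the sum cancels in the mean. *)
have [+ _] := leif_AGM t_ge0.
have -> : \sum_(p in A) t p = 2 * \sum_(i < n) y i * h i.
  rewrite -(sum_offdiag_Stieltjes _ hS).
  by rewrite (pair_big_dep xpredT (fun i j : 'I_n => j != i)).
have -> : discriminant y = discriminant h * \prod_(p in A) t p.
  rewrite -(pair_big_dep xpredT (fun i j : 'I_n => j != i) (fun i j => t (i, j))).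
  (* The product of the quotients is nonnegative, so it can be replaced by its absolute value and
     matched factor by factor. *)
  rewrite /= !discriminantE -[\prod_(i < n) \prod_(j < n | _) t _]ger0_norm.
    rewrite normr_prod -big_split; apply: eq_bigr => i _.
    rewrite normr_prod -big_split; apply: eq_bigr => j ij /=.
    rewrite /t /= normrM normfV mulrC divfK // normr_eq0 subr_eq0.
    by rewrite (inj_eq h_inj) eq_sym.
  by apply: prodr_ge0 => i _; apply: prodr_ge0 => j ij; apply: t_ge0.
rewrite card_offdiag => AGM; apply: ler_wpM2l.
  by rewrite discriminantE; apply: prodr_ge0 => i _; apply: prodr_ge0.
rewrite -exprM [(2 * 'C(n, 2))%N]mulnC.
suff <- : 2 * (\sum_(i < n) y i * h i) / ('C(n, 2) * 2)%:R =
  (\sum_(i < n) y i * h i) / 'C(n, 2)%:R by [].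
by rewrite natrM invfM [2 * _]mulrC mulrACA mulfV ?mulr1 // pnatr_eq0.
Qed.

Theorem theorem1p5 (R : realType) (n : nat) (S1 S2 : R) (x : 'I_n -> R)
  (n_ge2 : (2 <= n)%N)
  (S1_gt0 : 0 < S1) (S2_gt0 : 0 < S2)
  (S12_lb : (n%:R - 1) * S2 < S1 ^+ 2) (S12_ub : S1 ^+ 2 < n%:R * S2)
  (x_gt0 : forall i, 0 < x i)
  (sum_x : \sum_(i < n) x i = S1)
  (sum_x2 : \sum_(i < n) x i ^+ 2 = S2) :
  (potential_energy x / 'C(n, 2)%:R) ^+ 'C(n, 2)
    >= (2 * n)%:R ^+ 'C(n, 2) / (hyperfactorial n)%:R * discriminant x.
Proof.
have [s Hs] := hermite_real_rooted R n.
have us := uniq_hermite_roots Hs.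
have [h hs hx] := comonotone_reindexing x (size_hermite_roots Hs).
have h_inj : injective h.
  by apply/injectiveP; rewrite /injectiveb /dinjectiveb (perm_uniq hs).
have hS i : \sum_(j < n | j != i) (h i - h j)^-1 = h i.
  have hi : h i \in s by rewrite -(perm_mem hs) map_f // mem_enum.
  rewrite -[RHS](hermite_stieltjes Hs hi) -(perm_big _ hs) big_map /=.
  by rewrite big_enum_cond; apply: eq_bigl => j; rewrite (inj_eq h_inj).
have hD : discriminant h = (hyperfactorial n)%:R / 2 ^+ 'C(n, 2).
  rewrite discriminantE -(hermite_discriminant Hs) -(perm_big _ hs) big_map /=.
  rewrite big_enum; apply: eq_bigr => i _.
  rewrite -(perm_big _ hs) big_map /= big_enum_cond.
  by apply: eq_bigl => j; rewrite (inj_eq h_inj).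
have n_gt0 : 0 < n%:R :> R by rewrite ltr0n (leq_trans _ n_ge2).
have N_gt0 : 0 < 'C(n, 2)%:R :> R by rewrite ltr0n bin_gt0.
set N := 'C(n, 2) in hD N_gt0 *.
have h_sum : \sum_(i < n) h i = 0.
  (* A constant vector makes all quotients vanish. *)
  have := sum_offdiag_Stieltjes (fun=> 1) hS.
  under eq_bigr do under eq_bigr do rewrite subrr mul0r.
  under [in RHS]eq_bigr do rewrite mul1r.
  rewrite big1 => [/esym/eqP|i _]; last by rewrite big1.
  by rewrite mulf_eq0 pnatr_eq0 => /eqP.
have h_sqr : \sum_(i < n) h i ^+ 2 = N%:R.
  apply: (mulfI (x := 2)); first by rewrite pnatr_eq0.
  under eq_bigr do rewrite expr2.
  (* For [y = h] all quotients are 1, so their sum counts the ordered pairs. *)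
  rewrite -(sum_offdiag_Stieltjes h hS) -natrM mulnC -card_offdiag.
  rewrite (pair_big_dep xpredT (fun i j : 'I_n => j != i)) -sum1_card natr_sum.
  apply: eq_bigr => -[i j] /= ij; rewrite divff // subr_eq0 (inj_eq h_inj) eq_sym.
  exact: ij.
(* Subtracting the mean leaves the scalar product with the centered [h] unchanged and turns the sum
   of squares into $E/n$, the quantity wanted from Cauchy-Schwarz. *)
pose c := S1 / n%:R.
have dot_center : \sum_(i < n) x i * h i = \sum_(i < n) (x i - c) * h i.
  under [RHS]eq_bigr do rewrite mulrBl.
  by rewrite big_split /= sumrN -mulr_sumr h_sum mulr0 subr0.
have sqr_center : \sum_(i < n) (x i - c) ^+ 2 = potential_energy x / n%:R.
  transitivity (\sum_(i < n) (x i ^+ 2 - 2 * c * x i + c ^+ 2)).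
    by apply: eq_bigr => i _; ring.
  rewrite !big_split /= sumrN -mulr_sumr sumr_const card_ord -mulr_natl.
  rewrite potential_energyE sum_x sum_x2 /c; field.
  by rewrite gt_eqF.
have dot_le : (\sum_(i < n) x i * h i) ^+ 2 <= potential_energy x / n%:R * N%:R.
  by rewrite dot_center -sqr_center -h_sqr cauchy_schwarz_sum.
have Y_gt0 : 0 < (hyperfactorial n)%:R :> R.
  rewrite ltr0n /hyperfactorial big_nat_cond prodn_cond_gt0 // => k.
  by rewrite andbT expn_gt0 => /andP[/ltnW->].
have xD := discriminant_le_Stieltjes h_inj hS hx.
rewrite hD -/N in xD.
have coef_ge0 : 0 <= (2 * n)%:R ^+ N / (hyperfactorial n)%:R :> R.
  by rewrite divr_ge0 // exprn_ge0.
apply: le_trans (ler_wpM2l coef_ge0 xD) _.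
(* The coefficient cancels $\Delta(h) = Y(n)/2^N$ up to $n^N$, so only the bases of two $N$-th
   powers remain to be compared. *)
have -> u : (2 * n)%:R ^+ N / (hyperfactorial n)%:R *
    ((hyperfactorial n)%:R / 2 ^+ N * u ^+ N) = (n%:R * u) ^+ N :> R.
  rewrite natrM !exprMn; field.
  by rewrite (gt_eqF Y_gt0) expf_neq0 // pnatr_eq0.
apply: lerXn2r; rewrite ?nnegrE.
- by rewrite mulr_ge0 ?sqr_ge0 // ltW.
- by rewrite divr_ge0 ?ler0n // /potential_energy; do 2!apply: sumr_ge0 => ? _; rewrite sqr_ge0.
rewrite expr_div_n mulrA ler_pdivrMr ?exprn_gt0 //.
apply: le_trans (ler_wpM2l (ltW n_gt0) dot_le) _.
(* Both sides equal $E N$. *)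
rewrite le_eqVlt; apply/orP; left; apply/eqP; field.
by rewrite !gt_eqF.
Qed.
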